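(* (a) There are absolute constants $C,C'>0$ such that for every $n\ge 2$ and every directed graph $G_0$ on $n$ nodes, the directed two-hop walk process started from $G_0$ has terminated by round $\lceil Cn^2\log n\rceil$ with probability at least $1-C'/n$. (b) There is an absolute constant $c>0$ and, for infinitely many $n$, a weakly connected directed graph $G_0$ on $n$ nodes such that the probability that the directed two-hop walk process started from $G_0$ has terminated by round $\lfloor c\,n^2\ln n\rfloor$ tends to $0$ as $n\to\infty$.
   Context: Directed two-hop walk process: $G_0$ is a simple directed graph (no loops, no parallel arcs) on an $n$-node vertex set $V$. Given $G_t$, in round $t$ every node $x$ with at least one out-neighbor independently picks an out-neighbor $v$ of $x$ in $G_t$ uniformly at random and then, if $v$ has an out-neighbor, an out-neighbor $w$ of $v$ in $G_t$ uniformly at random, and the arc $(x,w)$ is added (nothing happens if $w=x$ or the arc already exists); $G_{t+1}$ is $G_t$ together with all arcs added in round $t$. Arcs are never removed. The process has terminated at time $t$ if for all nodes $u\neq v$ such that $G_0$ contains a directed path from $u$ to $v$, the arc $(u,v)$ belongs to $G_t$. *)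

(* Defs.v *)
From HB Require Import structures.
From mathcomp Require Import all_boot all_order all_algebra.
From Stdlib Require Import Reals ZArith.

Set Implicit Arguments.
Unset Strict Implicit.
Unset Printing Implicit Defensive.

Import GRing.Theory Num.Theory.
Local Open Scope ring_scope.

Notation graph n := {set 'I_n * 'I_n}.

Definition loopless n (G : graph n) : Prop := forall x : 'I_n, (x, x) \notin G.

Definition arcrel n (G : graph n) : rel 'I_n := fun u v => (u, v) \in G.

Definition reach n (G : graph n) : rel 'I_n := connect (arcrel G).

Definition weakly_connected n (G : graph n) : Prop :=
  forall u v : 'I_n, connect (fun a b => ((a, b) \in G) || ((b, a) \in G)) u v.

Definition outdeg n (G : graph n) (x : 'I_n) : nat := #|[set v | (x, v) \in G]|.

(* Outcome of one node's random choice in a round: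
   None                = x has no out-neighbour (no choice made);
   Some (v, None)      = x picked v, which has no out-neighbour;
   Some (v, Some w)    = x picked v and then w. *)
Definition outcome n := option ('I_n * option 'I_n).

Definition choice_prob n (G : graph n) (x : 'I_n) (o : outcome n) : rat :=
  match o with
  | None => if outdeg G x == 0%N then 1 else 0
  | Some (v, None) =>
      if ((x, v) \in G) && (outdeg G v == 0%N) then ((outdeg G x)%:R)^-1 else 0
  | Some (v, Some w) =>
      if ((x, v) \in G) && ((v, w) \in G)
      then ((outdeg G x)%:R * (outdeg G v)%:R)^-1 else 0
  end.

(* nodes choose independently *)
Definition profile_prob n (G : graph n) (f : {ffun 'I_n -> outcome n}) : rat :=
  \prod_(x : 'I_n) choice_prob G x (f x).

Definition next_graph n (G : graph n) (f : {ffun 'I_n -> outcome n}) : graph n :=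
  G :|: [set a : 'I_n * 'I_n | (a.1 != a.2) &&
           match f a.1 with Some (_, Some w) => w == a.2 | _ => false end].

Definition trans_prob n (G H : graph n) : rat :=
  \sum_(f : {ffun 'I_n -> outcome n}) (if next_graph G f == H then profile_prob G f else 0).

Fixpoint dist n (G0 : graph n) (t : nat) : graph n -> rat :=
  match t with
  | O => fun H => if H == G0 then 1 else 0
  | t'.+1 => fun H => \sum_(G : graph n) dist G0 t' G * trans_prob G H
  end.

Definition terminated n (G0 G : graph n) : bool :=
  [forall u : 'I_n, forall v : 'I_n, ((u != v) && reach G0 u v) ==> ((u, v) \in G)].

Definition term_prob n (G0 : graph n) (t : nat) : rat :=
  \sum_(H : graph n | terminated G0 H) dist G0 t H.

Definition int_to_Z (z : int) : Z :=
  match z with Posz k => Z.of_nat k | Negz k => (- Z.of_nat k.+1)%Z end.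

Definition rat_to_R (q : rat) : R :=
  (IZR (int_to_Z (numq q)) / IZR (int_to_Z (denq q)))%R.

Definition Rceil (x : R) : Z := (- Int_part (- x))%Z.
Definition Rfloor (x : R) : Z := Int_part x.

(* Main.v *)
(** Upper bound: let d be the distance from u to v in the current graph. Along a shortest
    path the hops over the arcs 2i and 2i+1 each occur with probability at least 1/n^2 and
    their effects on its length add up, so the expected value of d-1
    shrinks by a factor 1 - 1/(2n^2) per round. Summing d-1 over all pairs gives a potential
    of at most n^3 that is at least 1 until termination; Markov's inequality concludes.

    Lower bound: m starting points must each make one particular hop, which happens with
    probability at most 1/m^2 per round, independently for distinct starting points. The
    product over the starting points of 1 - r^s [hop still missing], with r = 1 - 1/m^2 and
    s the number of rounds left, is a supermartingale, so all hops have been made by round t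
    with probability at most (1 - r^t)^m, a coupon-collector bound. *)

Require Import Defs.
From HB Require Import structures.
From mathcomp Require Import all_boot all_order all_algebra.
From mathcomp Require Import lra zify.
From mathcomp Require Import Rstruct.
From Stdlib Require Import Reals ZArith Lra Lia.

Set Implicit Arguments.
Unset Strict Implicit.
Unset Printing Implicit Defensive.

(** * One round as an expectation; supermartingales along the process *)

Section Process.
Import Order.TTheory GRing.Theory Num.Theory.
Local Open Scope ring_scope.

Lemma sum_option (V : nmodType) (T : finType) (F : option T -> V) :
  \sum_o F o = F None + \sum_t F (Some t).
Proof.
rewrite (bigD1 None) //=; congr (_ + _).
by rewrite (reindex_omap Some (fun o => o)) /= => [|[]//]; apply: eq_bigl => t; rewrite eqxx.
Qed.

Lemma choice_prob_ge0 n (G : graph n) x o : 0 <= choice_prob G x o.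
Proof.
by case: o => [[v [w|]]|] /=; case: ifP => _; rewrite ?invr_ge0 ?mulr_ge0 ?ler0n ?ler01.
Qed.

Lemma sum_outdeg n (G : graph n) x (c : rat) :
  \sum_v (if (x, v) \in G then c else 0) = (outdeg G x)%:R * c.
Proof.
rewrite -big_mkcond /= /outdeg mulr_natl -sumr_const.
by apply: eq_bigl => v; rewrite inE.
Qed.

Lemma choice_prob_sum n (G : graph n) x : \sum_o choice_prob G x o = 1.
Proof.
rewrite sum_option.
have -> : \sum_p choice_prob G x (Some p) = \sum_v \sum_o choice_prob G x (Some (v, o)).
  by rewrite pair_bigA; apply: eq_bigr => -[].
under eq_bigr => v _.
  rewrite sum_option /=.
  have -> : \sum_w (if ((x, v) \in G) && ((v, w) \in G)
               then ((outdeg G x)%:R * (outdeg G v)%:R)^-1 else 0) =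
            if (x, v) \in G then (outdeg G v)%:R * ((outdeg G x)%:R * (outdeg G v)%:R)^-1 else 0 :> rat.
    by case: ifP => _; rewrite ?sum_outdeg // big1.
  (* Summed over the second hop, picking [v] has mass one over the out-degree of [x], whether or not
     [v] is a sink. *)
  have -> : (if ((x, v) \in G) && (outdeg G v == 0)%nat then (outdeg G x)%:R^-1 else 0) +
     (if (x, v) \in G then (outdeg G v)%:R * ((outdeg G x)%:R * (outdeg G v)%:R)^-1 else 0)
     = if (x, v) \in G then (outdeg G x)%:R^-1 else 0 :> rat.
    case: ((x, v) \in G) => /=; last by rewrite addr0.
    have [->|d0] := eqVneq (outdeg G v) 0%nat; first by rewrite mulr0n mul0r addr0.
    rewrite add0r invfM mulrCA divff ?mulr1 //.
    by rewrite pnatr_eq0.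
  over.
rewrite sum_outdeg /=; have [->|d0] := eqVneq (outdeg G x) 0%nat; first by rewrite mulr0n mul0r addr0.
by rewrite /= add0r divff // pnatr_eq0.
Qed.

Definition expect n (G : graph n) (X : {ffun 'I_n -> outcome n} -> rat) : rat :=
  \sum_f profile_prob G f * X f.

Lemma profile_prob_ge0 n (G : graph n) f : 0 <= profile_prob G f.
Proof. by apply: prodr_ge0 => x _; apply: choice_prob_ge0. Qed.

(** Independence of the nodes: a sum of products over all profiles distributes into a product of
    sums over single outcomes. *)
Lemma expect_prod n (G : graph n) (F : 'I_n -> outcome n -> rat) :
  expect G (fun f => \prod_x F x (f x)) = \prod_x \sum_o choice_prob G x o * F x o.
Proof.
rewrite bigA_distr_bigA; apply: eq_bigr => f _.
by rewrite /profile_prob -big_split.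
Qed.

Lemma expect_cst n (G : graph n) c : expect G (fun=> c) = c.
Proof.
rewrite /expect -mulr_suml.
have -> : \sum_f profile_prob G f = expect G (fun f => \prod_(x : 'I_n) 1).
  by apply: eq_bigr => f _; rewrite big1 // mulr1.
rewrite (expect_prod G (fun _ _ => 1)) big1 ?mul1r // => x _.
by under eq_bigr do rewrite mulr1; apply: choice_prob_sum.
Qed.

Lemma expect_local n (G : graph n) x (g : outcome n -> rat) :
  expect G (fun f => g (f x)) = \sum_o choice_prob G x o * g o.
Proof.
pose F y o := if y == x then g o else 1.
have -> : expect G (fun f => g (f x)) = expect G (fun f => \prod_y F y (f y)).
  by apply: eq_bigr => f _; rewrite -big_mkcond /= big_pred1_eq.
rewrite expect_prod (bigD1 x) //= /F eqxx.
rewrite [X in _ * X]big1 ?mulr1 // => y /negbTE ->.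
by under eq_bigr do rewrite mulr1; apply: choice_prob_sum.
Qed.

Lemma expect_le n (G : graph n) X Y :
  (forall f, 0 < profile_prob G f -> X f <= Y f) -> expect G X <= expect G Y.
Proof.
move=> XY; apply: ler_sum => f _.
have [/XY XYf|] := ltP 0 (profile_prob G f).
  by rewrite ler_wpM2l ?profile_prob_ge0.
by move=> p0; have /eqP -> : profile_prob G f == 0; rewrite ?mul0r // eq_le p0 profile_prob_ge0.
Qed.

Lemma expectD n (G : graph n) X Y :
  expect G (fun f => X f + Y f) = expect G X + expect G Y.
Proof. by rewrite /expect -big_split; apply: eq_bigr => f _; rewrite mulrDr. Qed.

Lemma expectZ n (G : graph n) c X : expect G (fun f => c * X f) = c * expect G X.
Proof. by rewrite /expect mulr_sumr; apply: eq_bigr => f _; rewrite mulrCA. Qed.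

Lemma expect_sum n (G : graph n) (I : finType) (P : pred I) (X : I -> _ -> rat) :
  expect G (fun f => \sum_(i | P i) X i f) = \sum_(i | P i) expect G (X i).
Proof.
rewrite /expect exchange_big; apply: eq_bigr => f _.
by rewrite mulr_sumr.
Qed.

Lemma trans_prob_expect n (G : graph n) (phi : graph n -> rat) :
  \sum_H trans_prob G H * phi H = expect G (fun f => phi (next_graph G f)).
Proof.
under eq_bigr do rewrite /trans_prob mulr_suml.
rewrite exchange_big; apply: eq_bigr => f _ /=.
rewrite (bigD1 (next_graph G f)) //= eqxx big1 ?addr0 // => H.
by rewrite eq_sym => /negbTE ->; rewrite mul0r.
Qed.

Lemma dist_step n (G0 : graph n) t (phi : graph n -> rat) :
  \sum_H Defs.dist G0 t.+1 H * phi H =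
  \sum_G Defs.dist G0 t G * expect G (fun f => phi (next_graph G f)).
Proof.
under eq_bigr do rewrite /= mulr_suml.
rewrite exchange_big; apply: eq_bigr => G _ /=.
by rewrite -trans_prob_expect mulr_sumr; apply: eq_bigr => H _; rewrite mulrA.
Qed.

Lemma dist0_sum n (G0 : graph n) (phi : graph n -> rat) :
  \sum_H Defs.dist G0 0 H * phi H = phi G0.
Proof.
rewrite (bigD1 G0) //= eqxx mul1r big1 ?addr0 // => H /negbTE ->.
by rewrite mul0r.
Qed.

Lemma dist_ge0 n (G0 : graph n) t H : 0 <= Defs.dist G0 t H.
Proof.
elim: t H => [|t IH] H /=; first by case: ifP.
apply: sumr_ge0 => G _; apply: mulr_ge0 => //; apply: sumr_ge0 => f _.
by case: ifP => // _; apply: profile_prob_ge0.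
Qed.

Lemma dist_total n (G0 : graph n) t : \sum_H Defs.dist G0 t H = 1.
Proof.
transitivity (\sum_H Defs.dist G0 t H * 1); first by apply: eq_bigr => H _; rewrite mulr1.
elim: t => [|t IH]; first exact: (dist0_sum G0 (fun=> 1)).
rewrite (dist_step G0 t (fun=> 1)) -[RHS]IH.
by apply: eq_bigr => G _; rewrite expect_cst.
Qed.

(** A profile of probability 0 may hop along pairs that are not arcs, which could break [broom_inv];
    hence the positivity condition. *)
Definition invariant n (I : graph n -> Prop) : Prop :=
  forall G f, I G -> 0 < profile_prob G f -> I (next_graph G f).

Lemma invariantP n (I : graph n -> Prop) G0 t H :
  invariant I -> I G0 -> 0 < Defs.dist G0 t H -> I H.
Proof.
move=> invI I0; elim: t H => [|t IH] H /=; first by case: eqP => [->|].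
rewrite lt_neqAle sumr_ge0 => [|G _]; last first.
  apply: mulr_ge0; first exact: dist_ge0.
  by apply: sumr_ge0 => f _; case: ifP => // _; apply: profile_prob_ge0.
rewrite andbT eq_sym psumr_neq0 => [/hasP[G _ /=]|G _]; last first.
  apply: mulr_ge0; first exact: dist_ge0.
  by apply: sumr_ge0 => f _; case: ifP => // _; apply: profile_prob_ge0.
rewrite lt_neqAle => /andP[]; rewrite eq_sym mulf_eq0 negb_or => /andP[dG tG] _.
have IG : I G by apply: IH; rewrite lt_neqAle eq_sym dG dist_ge0.
move: tG; rewrite psumr_neq0 => [/hasP[f _ /=]|f _]; last first.
  by case: ifP => // _; apply: profile_prob_ge0.
by case: eqP => // <- ; apply: invI.
Qed.

(** The first argument of [phi] counts the rounds still to come. The one-step inequality is applied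
    only to graphs of positive probability, where [I] holds. *)
Lemma dist_supermartingale n (I : graph n -> Prop) G0 (phi : nat -> graph n -> rat) t :
  invariant I -> I G0 ->
  (forall s G, I G -> expect G (fun f => phi s (next_graph G f)) <= phi s.+1 G) ->
  \sum_H Defs.dist G0 t H * phi 0%nat H <= phi t G0.
Proof.
move=> invI I0 step.
(* The offset [s] carries the induction on [t]: unrolling the last round turns [phi s] into
   [phi s.+1]. *)
have gen s : \sum_H Defs.dist G0 t H * phi s H <= phi (t + s)%nat G0; last first.
  by have := gen 0%nat; rewrite addn0.
elim: t s => [|t IH] s; first by rewrite dist0_sum.
rewrite dist_step addSnnS; apply: le_trans (IH _); apply: ler_sum => G _.
have [dG|] := ltP 0 (Defs.dist G0 t G).
  by rewrite ler_wpM2l ?dist_ge0 //; apply: step; apply: invariantP dG.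
by move=> d0; have /eqP -> : Defs.dist G0 t G == 0; rewrite ?mul0r // eq_le d0 dist_ge0.
Qed.

End Process.

(** * Upper bound: expected decay of distances *)

Section UpperBound.
Import Order.TTheory GRing.Theory Num.Theory.
Local Open Scope ring_scope.

(* Junk value: n if v cannot be reached from u. *)
Definition gdist n (G : graph n) (u v : 'I_n) : nat :=
  find (fun k => [exists p : k.-tuple 'I_n, path (arcrel G) u p && (last u p == v)])
       (iota 0 n).

Lemma gdist_le n (G : graph n) u p :
  path (arcrel G) u p -> (gdist G u (last u p) <= size p)%nat.
Proof.
(* A path of [n] or more arcs is covered by the cap: [find] never exceeds [n]. *)
move=> Gp; have [np|pn] := leqP n (size p).
  by apply: leq_trans np; rewrite -[X in (_ <= X)%nat](size_iota 0 n) find_size.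
rewrite leqNgt; apply/negP => /(before_find 0%nat).
rewrite nth_iota // add0n => /existsP[].
by exists (in_tuple p); rewrite Gp eqxx.
Qed.

(** A repetition-free path has fewer than [n] arcs, so the search through [iota 0 n] succeeds for
    reachable [v]. *)
Lemma gdist_path n (G : graph n) u v : reach G u v ->
  exists p, [/\ path (arcrel G) u p, last u p = v & size p = gdist G u v].
Proof.
case/connectP => p0 /shortenP[p Gp Up _] -> {p0}.
have pn : (size p < n)%nat.
  by have /card_uniqP /= <- := Up; rewrite -[X in (_ <= X)%nat]card_ord max_card.
have hp : has (fun k => [exists q : k.-tuple 'I_n,
    path (arcrel G) u q && (last u q == last u p)]) (iota 0 n).
  apply/hasP; exists (size p); first by rewrite mem_iota.
  by apply/existsP; exists (in_tuple p); rewrite Gp eqxx.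
have := nth_find 0%nat hp; rewrite nth_iota; last by rewrite -[X in (_ < X)%nat](size_iota 0 n) -has_find.
rewrite add0n => /existsP[q /andP[Gq /eqP lq]].
by exists q; split=> //; rewrite size_tuple.
Qed.

Lemma gdist_triangle n (G : graph n) u v w : reach G u v -> reach G v w ->
  (gdist G u w <= gdist G u v + gdist G v w)%nat.
Proof.
move=> /gdist_path[p [Gp <- <-]] /gdist_path[q [Gq <- <-]].
by rewrite -last_cat -size_cat; apply: gdist_le; rewrite cat_path Gp Gq.
Qed.

Lemma gdist_far n (G : graph n) u v :
  reach G u v -> u != v -> (u, v) \notin G -> (1 < gdist G u v)%nat.
Proof.
move=> /gdist_path[p [Gp lp <-]] uv nG.
case: p Gp lp => [|x [|y p]] //=; first by move=> _ E; rewrite E eqxx in uv.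
by rewrite andbT /arcrel => Gx E; rewrite -E Gx in nG.
Qed.

Lemma gdist_neq n (G : graph n) u v : u != v -> (0 < gdist G u v)%nat.
Proof.
case: n G u v => [|n] G u v uv; first by case: u {uv}.
rewrite /gdist /=; case: existsP => // -[p].
by rewrite (tuple0 p) /= (negbTE uv).
Qed.

Lemma gdist_max n (G : graph n) u v : (gdist G u v <= n)%nat.
Proof. by rewrite -[X in (_ <= X)%nat](size_iota 0 n) find_size. Qed.

Lemma next_graph_sub n (G : graph n) f : G \subset next_graph G f.
Proof. exact: subsetUl. Qed.

Lemma outdeg_max n (G : graph n) x : (outdeg G x <= n)%nat.
Proof. by rewrite -[X in (_ <= X)%nat](card_ord n) max_card. Qed.

Lemma outdeg_gt0 n (G : graph n) x v : (x, v) \in G -> (0 < outdeg G x)%nat.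
Proof. by move=> xv; apply/card_gt0P; exists v; rewrite inE. Qed.

(** The outcome has probability the inverse of the product of two out-degrees, each at most [n]. *)
Lemma expect_two_hop n (G : graph n) x v w : (x, v) \in G -> (v, w) \in G ->
  (n%:R ^+ 2)^-1 <= expect G (fun f => (f x == Some (v, Some w))%:R).
Proof.
move=> xv vw; rewrite (expect_local G x (fun o => (o == Some (v, Some w))%:R)).
rewrite (bigD1 (Some (v, Some w))) //= eqxx mulr1 xv vw big1 ?addr0 => [|o /negbTE ->]; last first.
  by rewrite mulr0.
have x0 := outdeg_gt0 xv; have v0 := outdeg_gt0 vw.
have n0 : (0 < n)%nat by case: n x {v w xv vw x0 v0} G => [[]|].
rewrite lef_pV2 ?posrE ?mulr_gt0 ?exprn_gt0 ?ltr0n //.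
by rewrite expr2 ler_pM ?ler0n ?ler_nat ?outdeg_max.
Qed.

Lemma reach_sub n (G H : graph n) u v : G \subset H -> reach G u v -> reach H u v.
Proof.
by move=> /subsetP GH; apply: connect_sub => a b /GH ab; apply: connect1.
Qed.

Lemma path_reach n (G : graph n) u p : path (arcrel G) u p -> reach G u (last u p).
Proof. by move=> Gp; apply/connectP; exists p. Qed.

(* The hops over disjoint pairs of consecutive arcs of a path shorten it additively,
   so only the marginal probability of each hop matters, not independence. *)
Lemma expect_gdist_path n (G : graph n) u p : path (arcrel G) u p ->
  expect G (fun f => (gdist (next_graph G f) u (last u p))%:R)
    <= (size p)%:R - ((size p)./2)%:R * (n%:R ^+ 2)^-1.
Proof.
(* Strong induction on the length, since two arcs are removed at a time. *)
have [k] := ubnP (size p); elim: k => // k IH in u p *.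
case: p => [|v [|w p]] /=.
- move=> _ _; rewrite mul0r subr0 -[leRHS](expect_cst G); apply: expect_le => f _.
  by rewrite ler_nat (@gdist_le _ _ u [::]).
- move=> _; rewrite andbT => uv; rewrite mul0r subr0 -[leRHS](expect_cst G).
  apply: expect_le => f _; rewrite ler_nat (@gdist_le _ _ u [:: v]) //=.
  by rewrite andbT /arcrel (subsetP (next_graph_sub G f)).
rewrite ltnS => sp /and3P[uv vw Gp].
have {}IH := IH w p (ltnW sp) Gp.
have uw : reach G u w.
  by apply: connect_trans (connect1 uv) (connect1 vw).
pose hop f : rat := (f u == Some (v, Some w) :> outcome n)%:R.
(* The first two arcs cost 2, or at most 1 if [u] makes the hop to [w]; the rest of the path is left
   to the induction hypothesis. *)
apply: (@le_trans _ _ (expect G (fun f => 2 + (-1) * hop f +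
                                 (gdist (next_graph G f) w (last w p))%:R))).
  apply: expect_le => f _.
  have Gf := next_graph_sub G f.
  have tri := gdist_triangle (reach_sub Gf uw) (reach_sub Gf (path_reach Gp)).
  apply: (@le_trans _ _ ((gdist (next_graph G f) u w)%:R +
                         (gdist (next_graph G f) w (last w p))%:R)).
    by rewrite -natrD ler_nat.
  rewrite lerD2r /hop; case: eqP => [fu|_]; last first.
    rewrite mulr0 addr0 ler_nat (@gdist_le _ _ u [:: v; w]) //= andbT /arcrel.
    by rewrite !(subsetP Gf).
  rewrite mulN1r -[2]/(1 + 1) addrK.
  (* If [w = u] the hop adds no arc, but then the distance is 0. *)
  rewrite (ler_nat _ _ 1); case: (eqVneq u w) => [<-|nuw].
    exact: leq_trans (@gdist_le _ _ u [::] isT) _.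
  rewrite (@gdist_le _ _ u [:: w]) //= andbT /arcrel !inE /= nuw fu eqxx orbT //.
rewrite !expectD expectZ expect_cst.
have := expect_two_hop uv vw; rewrite -/hop => Hhop.
move: IH Hhop; rewrite -[(size p).+2]addn2 -[((size p)./2).+1]addn1 !natrD.
set a := expect _ _; set b := expect _ _; set q := (_ ^+ 2)^-1; rewrite mulrDl mul1r.
move=> *; lra.
Qed.

(** A shortest path with [d] arcs holds [d./2] disjoint pairs, which is at least [(d - 1) / 2]; so
    the expected gain is proportional to [d - 1]. *)
Lemma expect_gdist n (G : graph n) u v : reach G u v -> u != v ->
  expect G (fun f => ((gdist (next_graph G f) u v).-1)%:R)
    <= (1 - (2 * n%:R ^+ 2)^-1) * ((gdist G u v).-1)%:R.
Proof.
move=> uv nuv; have [p [Gp lp sp]] := gdist_path uv.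
have := expect_gdist_path Gp; rewrite lp sp.
have predE (H : graph n) : ((gdist H u v).-1)%:R = (gdist H u v)%:R + (-1) * 1 :> rat.
  by rewrite mulr1 -subn1 natrB ?gdist_neq.
have -> : expect G (fun f => ((gdist (next_graph G f) u v).-1)%:R) =
    expect G (fun f => (gdist (next_graph G f) u v)%:R) - 1.
  rewrite -[X in _ - X](expect_cst G 1) -mulN1r -expectZ -expectD.
  by apply: eq_bigr => f _; rewrite predE.
move: (gdist_neq G nuv); case: (gdist G u v) => // d _ /=.
have : (d%:R : rat) <= 2 * (uphalf d)%:R.
  by rewrite -natrM ler_nat mul2n -{1}(odd_double_half d) uphalf_half doubleD leq_add2r; case: odd.
rewrite [(2 * _)^-1]invfM -[d.+1]addn1 natrD.
have : 0 <= (n%:R ^+ 2)^-1 :> rat by rewrite invr_ge0 exprn_ge0 ?ler0n.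
have arith (q x y E : rat) : 0 <= q -> x <= 2 * y -> E <= x + 1 - y * q ->
    E - 1 <= (1 - 2^-1 * q) * x by nra.
exact: arith.
Qed.

(** The pairs come from [G0], as in [terminated], so the index set stays fixed while the graph
    grows. *)
Definition total_gap n (G0 G : graph n) : rat :=
  \sum_(p | (p.1 != p.2) && reach G0 p.1 p.2) ((gdist G p.1 p.2).-1)%:R.

(** A pair whose arc is missing is at distance at least 2 and alone contributes at least 1. *)
Lemma total_gap_terminated n (G0 G : graph n) : G0 \subset G -> ~~ terminated G0 G ->
  1 <= total_gap G0 G.
Proof.
move=> GG; rewrite negb_forall => /existsP[u]; rewrite negb_forall => /existsP[v].
rewrite negb_imply => /andP[/andP[uv Ruv] nG].
rewrite /total_gap (bigD1 (u, v)) ?uv //= -[leLHS]addr0 lerD ?sumr_ge0 //.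
rewrite (ler_nat _ 1) -ltnS prednK ?gdist_neq //.
by rewrite gdist_far ?(reach_sub GG).
Qed.

Lemma total_gap_max n (G0 G : graph n) : total_gap G0 G <= n%:R ^+ 3.
Proof.
apply: (@le_trans _ _ (\sum_(p : 'I_n * 'I_n) n%:R)).
  rewrite /total_gap big_mkcond; apply: ler_sum => p _; case: ifP => _; rewrite ?ler0n //.
  by rewrite ler_nat (leq_trans (leq_pred _)) ?gdist_max.
by rewrite sumr_const card_prod card_ord -mulrnA -natrX !expnS expn0 muln1.
Qed.

Lemma term_prob_lower n (G0 : graph n) t : (0 < n)%nat ->
  1 - n%:R ^+ 3 * (1 - (2 * n%:R ^+ 2)^-1) ^+ t <= term_prob G0 t.
Proof.
move=> n0; set r := 1 - _^-1.
have r0 : 0 <= r.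
  rewrite /r subr_ge0 invf_le1 ?mulr_gt0 ?exprn_gt0 ?ltr0n // -natrX -natrM ler1n.
  by rewrite muln_gt0 expn_gt0 n0.
have inv : invariant (fun G : graph n => G0 \subset G).
  by move=> G f GG _; apply: subset_trans GG (next_graph_sub G f).
(* Each round shrinks the expected gap by [r], so the gap weighted by [r ^+ s], with [s] rounds
   left, is a supermartingale. *)
have := @dist_supermartingale n _ G0 (fun s G => r ^+ s * total_gap G0 G) t inv (subxx _).
move=> /(_ _)/(le_trans _) gap.
have {gap} : \sum_H Defs.dist G0 t H * (~~ terminated G0 H)%:R <= n%:R ^+ 3 * r ^+ t.
  apply: (@le_trans _ _ (r ^+ t * total_gap G0 G0)); last first.
    by rewrite mulrC ler_wpM2r ?exprn_ge0 // total_gap_max.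
  apply: gap; last first.
    move=> s G GG; rewrite expectZ exprSr -mulrA ler_wpM2l ?exprn_ge0 // expect_sum mulr_sumr.
    apply: ler_sum => -[u v] /= /andP[uv Ruv].
    by apply: expect_gdist => //; apply: reach_sub Ruv.
  (* Markov's inequality: the gap dominates the indicator of non-termination. *)
  apply: ler_sum => H _; rewrite mul1r.
  have [dH|] := ltP 0 (Defs.dist G0 t H); last first.
    move=> d0; have /eqP -> : Defs.dist G0 t H == 0; rewrite ?mul0r //.
    by rewrite eq_le d0 dist_ge0.
  rewrite ler_wpM2l ?dist_ge0 //; case: (boolP (terminated G0 H)) => [_|nT].
    by apply: sumr_ge0.
  by apply: total_gap_terminated nT; apply: (invariantP inv _ dH); apply: subxx.
have -> : term_prob G0 t = 1 - \sum_H Defs.dist G0 t H * (~~ terminated G0 H)%:R.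
  rewrite -[X in X - _](dist_total G0 t) -sumrB /term_prob big_mkcond; apply: eq_bigr => H _.
  by case: terminated; rewrite ?mulr0 ?mulr1 ?subr0 ?subrr.
by move=> h; rewrite lerD2l lerN2.
Qed.

End UpperBound.

(** * Lower bound: the broom graph *)

Section LowerBound.
Import Order.TTheory GRing.Theory Num.Theory.
Local Open Scope ring_scope.

(* Nodes below m are the starting points, m, ..., 2m-1 are sinks, 2m is the hub and
   2m+1 the target sink. Starting points and hub each have m arcs to the other sinks,
   so the missing hop start -> hub -> target has probability at most 1/m^2. *)
Definition broom m : graph m.*2.+2 :=
  [set p : 'I_(m.*2.+2) * 'I_(m.*2.+2) | ((p.1 < m) && (m <= p.2 <= m.*2)) ||
           ((p.1 == m.*2 :> nat) && ((m <= p.2 < m.*2) || (p.2 == m.*2.+1 :> nat)))]%nat.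

Definition hub m : 'I_(m.*2.+2) := inord m.*2.

Lemma hubE m : hub m = m.*2 :> nat.
Proof. by rewrite inordK. Qed.

Lemma broom_loopless m : loopless (broom m).
Proof. by move=> x; rewrite inE /=; apply/negP; lia. Qed.

Lemma broom_weakly_connected m : weakly_connected (broom m).
Proof.
set e : rel 'I_(m.*2.+2) := fun a b => ((a, b) \in broom m) || ((b, a) \in broom m).
have eC : symmetric e by move=> a b; rewrite /e orbC.
have toh u : connect e u (hub m).
  have [->|uh] := eqVneq u (hub m); first exact: connect0.
  apply: connect1; rewrite /e !inE /= hubE.
  have : (u : nat) <> m.*2.
    move=> E.
    by case/eqP: uh; apply: val_inj; rewrite /= hubE.
  by move=> neq; have := ltn_ord u; lia.
move=> u v; apply: connect_trans (toh u) _.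
by rewrite (sym_connect_sym eC).
Qed.

(** The second clause keeps every sink a sink and makes the hub the only possible middle node of a
    two-hop walk. *)
Definition broom_inv m (G : graph m.*2.+2) : Prop :=
  broom m \subset G /\
  forall x y, (x, y) \in G ->
    ((x < m) && (m <= y) || [&& x == m.*2 :> nat, m <= y & y != m.*2 :> nat])%nat.

Lemma broom_inv0 m : broom_inv (broom m).
Proof. by split=> // x y; rewrite inE /=; have := ltn_ord y; lia. Qed.

Lemma invariant_broom m : invariant (@broom_inv m).
Proof.
move=> G f [sub arcs] pf; split; first exact: subset_trans sub (next_graph_sub G f).
move=> x y; rewrite 2!inE /= => /orP[/arcs //|/andP[_]].
(* A product of positive probability has no zero factor, so the walk of [x] follows arcs of [G]. *)
have : choice_prob G x (f x) != 0.
  by move: pf; rewrite lt_neqAle eq_sym => /andP[/prodf_neq0/(_ x isT)].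
case: (f x) => [[v [w|]]|] //=; case: ifP => [/andP[/arcs xv /arcs vw] _ /eqP <-|]; last first.
  by rewrite eqxx.
lia.
Qed.

Lemma outdeg_broom m (G : graph m.*2.+2) x :
  (forall y : 'I_(m.*2.+2), (m <= y < m.*2)%nat -> (x, y) \in G) -> (m <= outdeg G x)%nat.
Proof.
move=> Gx; pose g (i : 'I_m) : 'I_(m.*2.+2) := inord (m + i).
have gE i : g i = (m + i)%nat :> nat by rewrite inordK //; have := ltn_ord i; lia.
have g_inj : injective g.
  by move=> i j /(congr1 val) /=; rewrite !gE => /addnI/val_inj.
rewrite -[leqLHS]card_ord -(card_imset _ g_inj) subset_leq_card //.
apply/subsetP => _ /imsetP[i _ ->]; rewrite inE; apply: Gx.
by rewrite gE; have := ltn_ord i; lia.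
Qed.

Definition joins n (y : 'I_n) (o : outcome n) : bool :=
  if o is Some (_, Some w) then w == y else false.

Lemma broom_join_prob m (G : graph m.*2.+2) (x : 'I_(m.*2.+2)) : broom_inv G -> (0 < m)%nat -> (x < m)%nat ->
  \sum_o choice_prob G x o * (joins ord_max o)%:R <= (m%:R ^+ 2)^-1.
Proof.
move=> [sub arcs] m0 xm; have /subsetP {}sub := sub.
(* Any other outcome ending at the target has probability 0, because [broom_inv] forces the middle
   node to be the hub. *)
rewrite (bigD1 (Some (hub m, Some ord_max))) //= eqxx mulr1 big1 ?addr0; last first.
  move=> [[v [w|]]|] //= neq; rewrite ?mulr0 //.
  case: eqP => [E|_]; rewrite ?mulr0 // mulr1; case: ifP => // /andP[/arcs xv /arcs vw].
  case/eqP: neq; rewrite E; congr (Some (_, _)); apply: val_inj; rewrite /= hubE.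
  lia.
have xh : (x, hub m) \in G by apply: sub; rewrite inE /= hubE; lia.
have ht : (hub m, ord_max) \in G by apply: sub; rewrite inE /= hubE; lia.
have dx : (m <= outdeg G x)%nat.
  by apply: outdeg_broom => y ym; apply: sub; rewrite inE /=; lia.
have dh : (m <= outdeg G (hub m))%nat.
  by apply: outdeg_broom => y ym; apply: sub; rewrite inE /= hubE; lia.
rewrite xh ht lef_pV2 ?posrE ?mulr_gt0 ?exprn_gt0 ?ltr0n ?(leq_trans m0) //.
by rewrite expr2 ler_pM ?ler0n ?ler_nat.
Qed.

(** While its arc is missing, the factor of [x] is the chance that an event of probability [1 - r]
    per round occurs within [s] rounds. For [s = 0] the product is the indicator that all these arcs
    are present. *)
Definition broom_potential m (r : rat) s (G : graph m.*2.+2) : rat :=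
  \prod_(x : 'I_(m.*2.+2) | (x < m)%nat) (1 - r ^+ s * ((x, ord_max) \notin G)%:R).

(** Whether [x] gains its arc depends on the choice of [x] alone, so [expect_prod] splits the
    product and the factors are compared one by one. *)
Lemma broom_potential_step m (r : rat) s (G : graph m.*2.+2) :
  broom_inv G -> (0 < m)%nat -> r = 1 - (m%:R ^+ 2)^-1 ->
  expect G (fun f => broom_potential r s (next_graph G f)) <= broom_potential r s.+1 G.
Proof.
move=> IG m0 rE.
have r0 : 0 <= r.
  by rewrite rE subr_ge0 invf_le1 ?exprn_gt0 ?ltr0n // -natrX ler1n expn_gt0 m0.
have r1 : r <= 1 by rewrite rE gerBl invr_ge0 exprn_ge0 ?ler0n.
pose F (x : 'I_(m.*2.+2)) (o : outcome m.*2.+2) : rat := if (x < m)%nat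
  then 1 - r ^+ s * (~~ (((x, ord_max) \in G) || joins ord_max o))%:R else 1.
have -> : expect G (fun f => broom_potential r s (next_graph G f)) =
          expect G (fun f => \prod_x F x (f x)).
  apply: eq_bigr => f _; congr (_ * _).
  rewrite /broom_potential big_mkcond; apply: eq_bigr => x _; rewrite /F.
  case: ifP => // xm; rewrite 2!inE /=.
  (* The new arc is not discarded as a loop. *)
  have -> : x != ord_max by apply/eqP => E; rewrite E /= in xm; lia.
  by [].
have F0 x o : 0 <= F x o.
  rewrite /F; case: ifP => // _; rewrite subr_ge0.
  by apply: mulr_ile1; rewrite ?exprn_ge0 ?exprn_ile1 //; case: (~~ _).
rewrite expect_prod /broom_potential [leRHS]big_mkcond; apply: ler_prod => x _.
rewrite sumr_ge0 => [|o _]; last by rewrite mulr_ge0 ?choice_prob_ge0.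
rewrite /F; case: ifP => xm /=; last first.
  by under eq_bigr do rewrite mulr1; rewrite choice_prob_sum.
case: (boolP (_ \in G)) => /= _.
  by rewrite !mulr0 !subr0; under eq_bigr do rewrite mulr1; rewrite choice_prob_sum.
have -> : \sum_o choice_prob G x o * (1 - r ^+ s * (~~ joins ord_max o)%:R) =
   1 - r ^+ s * (1 - \sum_o choice_prob G x o * (joins ord_max o)%:R).
  rewrite -[X in r ^+ s * (X - _)](choice_prob_sum G x) -sumrB mulr_sumr.
  rewrite -[X in _ = X - _](choice_prob_sum G x) -sumrB; apply: eq_bigr => o _.
  case: joins; first by rewrite !mulr0 subr0 !mulr1 subrr mulr0 subr0.
  by rewrite !mulr1 mulr0 subr0 mulrBr mulr1 mulrC.
(* A missing arc stays missing with probability at least [r], which supplies the extra power of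
   [r]. *)
rewrite mulr1 exprSr lerD2l lerN2 ler_wpM2l ?exprn_ge0 // rE lerD2l lerN2.
exact: broom_join_prob.
Qed.

Lemma term_prob_upper m t : (0 < m)%nat ->
  term_prob (broom m) t <= (1 - (1 - (m%:R ^+ 2)^-1) ^+ t) ^+ m.
Proof.
move=> m0; set r := 1 - _^-1.
(* In the broom itself no starting point has an arc to the target, so all [m] factors equal
   [1 - r ^+ t]. *)
have -> : (1 - r ^+ t) ^+ m = broom_potential r t (broom m).
  rewrite /broom_potential big_ord_narrow; first lia.
  move=> le; rewrite (eq_bigr (fun=> 1 - r ^+ t)) ?prodr_const ?card_ord // => i _.
  by rewrite inE /=; case: orP => [[]|_]; rewrite ?mulr1 //; have := ltn_ord i; lia.
have step := @dist_supermartingale _ _ (broom m) (@broom_potential m r) t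
  (@invariant_broom m) (@broom_inv0 m).
apply: le_trans (step _); last by move=> s G IG; apply: broom_potential_step.
rewrite /term_prob big_mkcond; apply: ler_sum => H _; case: ifP => [T|_]; last first.
  rewrite mulr_ge0 ?dist_ge0 //; apply: prodr_ge0 => x _.
  by rewrite mul1r; case: (~~ _).
rewrite -[leLHS]mulr1 ler_wpM2l ?dist_ge0 //.
rewrite /broom_potential big1 // => x xm.
(* Termination forces this arc, since the target is reachable from [x] through the hub. *)
suff -> : (x, ord_max) \in H by rewrite mulr0 subr0.
have /forallP/(_ x)/forallP/(_ ord_max)/implyP := T; apply.
apply/andP; split; first by apply/eqP => E; rewrite E /= in xm; lia.
by apply: (@connect_trans _ _ (hub m)); apply: connect1; rewrite /arcrel inE /= hubE; lia.
Qed.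

End LowerBound.

(** * Transfer of the bounds from rationals to reals *)

Section RealBounds.
Import Order.TTheory GRing.Theory Num.Theory.
Local Open Scope ring_scope.

(** Identification with the ring morphism [ratr] gives access to the morphism and order lemmas. *)
Lemma rat_to_RE q : rat_to_R q = ratr q.
Proof.
have E z : IZR (int_to_Z z) = z%:~R.
  case: z => k; first by rewrite /= -INR_IZR_INZ INRE.
  by rewrite /int_to_Z opp_IZR -INR_IZR_INZ INRE NegzE mulrNz.
by rewrite /rat_to_R !E RdivE /ratr.
Qed.

Lemma rat_to_R_ge0 q : 0 <= q -> Rle 0 (rat_to_R q).
Proof. by move=> q0; rewrite rat_to_RE; apply/RleP; rewrite ler0q. Qed.

Lemma rat_to_R_term_prob_lower (n : nat) (G0 : graph n) t : (0 < n)%nat ->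
  (1 - INR n ^ 3 * (1 - / (2 * INR n ^ 2)) ^ t <= rat_to_R (term_prob G0 t))%R.
Proof.
move=> n0; have := term_prob_lower G0 t n0; rewrite rat_to_RE -(ler_rat R).
rewrite rmorphB rmorphM !rmorphXn rmorphB fmorphV rmorphM rmorphXn !rmorph_nat rmorph1.
by move=> h; apply/RleP; move: h; rewrite -INRE -!RpowE.
Qed.

Lemma rat_to_R_term_prob_upper m t : (0 < m)%nat ->
  (rat_to_R (term_prob (broom m) t) <= (1 - (1 - / INR m ^ 2) ^ t) ^ m)%R.
Proof.
move=> m0; have := term_prob_upper t m0; rewrite rat_to_RE -(ler_rat R).
rewrite rmorphXn rmorphB rmorphXn rmorphB fmorphV rmorphXn !rmorph_nat rmorph1.
by move=> h; apply/RleP; move: h; rewrite -INRE -!RpowE.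
Qed.

Lemma term_prob_ge0 n (G0 : graph n) t : 0 <= term_prob G0 t.
Proof. by apply: sumr_ge0 => H _; apply: dist_ge0. Qed.

End RealBounds.

(** * Exponential estimates and the constants *)

Section Asymptotics.
Local Open Scope R_scope.

Lemma exp_nat_mul x t : exp (x * INR t) = exp x ^ t.
Proof.
elim: t => [|t IH]; first by rewrite Rmult_0_r exp_0.
rewrite S_INR Rmult_plus_distr_l Rmult_1_r exp_plus IH /=; Lra.lra.
Qed.

(** From [1 - x <= exp (- x)]; the hypothesis keeps the base nonnegative. *)
Lemma pow_le_exp x t : x <= 1 -> (1 - x) ^ t <= exp (- x * INR t).
Proof.
move=> x1; rewrite exp_nat_mul; apply: pow_incr; split; first Lra.lra.
by have := exp_ineq1_le (- x); Lra.lra.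
Qed.

Lemma exp_neg_le_inv y : 0 <= y -> exp (- y) <= / (1 + y).
Proof.
move=> y0; rewrite exp_Ropp; apply: Rinv_le_contravar; first Lra.lra.
exact: exp_ineq1_le.
Qed.

(** Here [exp (- 2x) <= 1 / (1 + 2x) <= 1 - x], the last step because
    [(1 - x) (1 + 2x) = 1 + x (1 - 2x)]. *)
Lemma exp_le_pow x t : 0 <= x <= 1 / 2 -> exp (- (2 * x) * INR t) <= (1 - x) ^ t.
Proof.
move=> x01; rewrite exp_nat_mul; apply: pow_incr; split; first exact/Rlt_le/exp_pos.
apply: (Rle_trans _ (/ (1 + 2 * x))); first by apply: exp_neg_le_inv; Lra.lra.
apply: (Rmult_le_reg_r (1 + 2 * x)); first Lra.lra.
rewrite Rinv_l; last Lra.lra.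
Lra.nra.
Qed.

Lemma exp_le_exp x y : x <= y -> exp x <= exp y.
Proof. by case=> [/exp_increasing/Rlt_le|->]; last exact: Rle_refl. Qed.

Lemma ln_ge0 x : 1 <= x -> 0 <= ln x.
Proof. by case=> [x1|<-]; rewrite -ln_1; [apply/Rlt_le/ln_increasing; Lra.lra|apply: Rle_refl]. Qed.

Lemma INR_Rceil x : 0 <= x -> x <= INR (Z.to_nat (Rceil x)).
Proof.
move=> x0; have [h _] := base_Int_part (- x).
have xc : x <= IZR (Rceil x) by rewrite /Rceil opp_IZR; Lra.lra.
rewrite INR_IZR_INZ Z2Nat.id //.
by apply: le_IZR; Lra.lra.
Qed.

Lemma INR_Rfloor x : 0 <= x -> INR (Z.to_nat (Rfloor x)) <= x.
Proof.
move=> x0; have [h1 h2] := base_Int_part x.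
rewrite INR_IZR_INZ Z2Nat.id //.
(* The floor is nonnegative, so [Z.to_nat] does not truncate it. *)
suff : (-1 < Int_part x)%Z by rewrite /Rfloor; Lia.lia.
by apply: lt_IZR; Lra.lra.
Qed.

Lemma two_hop_upper (n : nat) (G0 : graph n) : (2 <= n)%nat ->
  rat_to_R (term_prob G0 (Z.to_nat (Rceil (8 * INR n ^ 2 * ln (INR n))))) >= 1 - 1 / INR n.
Proof.
move=> n2; have N2 : 2 <= INR n by apply: (le_INR 2); apply/leP.
set t := Z.to_nat _; set N := INR n in N2 *; have N0 : 0 < N by Lra.lra.
have lnN : 0 <= ln N by apply: ln_ge0; Lra.lra.
have tge : 8 * N ^ 2 * ln N <= INR t by apply: INR_Rceil; Lra.nra.
apply: Rle_ge; apply: (Rle_trans _ _ _ _ (rat_to_R_term_prob_lower G0 t (ltnW n2))).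
rewrite -/N; set x := / (2 * N ^ 2).
have x0 : 0 < x by apply: Rinv_0_lt_compat; Lra.nra.
have xN : x * (2 * N ^ 2) = 1 by rewrite /x; field; Lra.lra.
have x1 : x <= 1 by Lra.nra.
(* The constant 8 comes from here: at rate [1 / (2 N^2)] it yields the exponent [4 ln N], which
   beats the initial potential [N^3] by a factor [N]. *)
have pw : (1 - x) ^ t <= / N ^ 4.
  apply: Rle_trans (pow_le_exp _ x1) _.
  apply: (Rle_trans _ (exp (- (ln N * INR 4)))).
    apply: exp_le_exp; rewrite -Ropp_mult_distr_l; apply: Ropp_le_contravar.
    have : x * (8 * N ^ 2 * ln N) <= x * INR t by apply: Rmult_le_compat_l; Lra.lra.
    have -> : x * (8 * N ^ 2 * ln N) = x * (2 * N ^ 2) * (ln N * 4) by ring.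
    by rewrite xN /=; Lra.lra.
  by rewrite exp_Ropp exp_nat_mul exp_ln //; apply: Rle_refl.
have : N ^ 3 * (1 - x) ^ t <= N ^ 3 * / N ^ 4.
  by apply: Rmult_le_compat_l pw; apply: pow_le; Lra.lra.
have -> : N ^ 3 * / N ^ 4 = 1 / N by field; Lra.lra.
Lra.lra.
Qed.

(** The bound is squared to avoid square roots: [P <= 1 / (y M)] while
    [y^2 >= 1 / N >= 1 / (3 M)]. *)
Lemma broom_slow m : (2 <= m)%nat ->
  let N := INR m.*2.+2 in
  let P := rat_to_R (term_prob (broom m) (Z.to_nat (Rfloor (/ 36 * N ^ 2 * ln N)))) in
  P * P <= 3 / INR m.
Proof.
move=> m2 N; set t := Z.to_nat _; move=> P; set M := INR m.
have M2 : 2 <= M by apply: (le_INR 2); apply/leP.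
have NE : N = 2 * M + 2 by rewrite /N 2!S_INR -muln2 mult_INR /= -/M; Lra.lra.
have lnN : 0 <= ln N by apply: ln_ge0; Lra.lra.
have tle : INR t <= / 36 * N ^ 2 * ln N.
  by apply: INR_Rfloor; apply: Rmult_le_pos => //; Lra.nra.
have P0 : 0 <= P by apply: rat_to_R_ge0; apply: term_prob_ge0.
have : P <= (1 - (1 - / M ^ 2) ^ t) ^ m.
  by apply: rat_to_R_term_prob_upper; apply: leq_trans m2.
set x := / M ^ 2; set y := (1 - x) ^ t => Py.
have xM : x * M ^ 2 = 1 by rewrite /x; field; Lra.lra.
have x0 : 0 < x by apply: Rinv_0_lt_compat; Lra.nra.
have x12 : x <= 1 / 2 by Lra.nra.
have y0 : 0 < y by apply: pow_lt; Lra.lra.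
have y1 : y <= 1.
  rewrite -(pow1 t); apply: pow_incr; Lra.lra.
(* The constant 1/36 comes from here: [N <= 3 M] gives [x N^2 <= 9], hence [x t <= ln N / 4] and
   [y^2 >= exp (- 4 x t) >= 1 / N]. *)
have yN : / N <= y * y.
  have -> : / N = exp (- ln N) by rewrite exp_Ropp exp_ln //; Lra.lra.
  apply: (Rle_trans _ (exp (- (2 * x) * INR t) * exp (- (2 * x) * INR t))); last first.
    have e0 := exp_pos (- (2 * x) * INR t).
    have : exp (- (2 * x) * INR t) <= y by apply: exp_le_pow; Lra.lra.
    by move=> ?; apply: Rmult_le_compat; Lra.lra.
  rewrite -exp_plus; apply: exp_le_exp.
  have : x * INR t <= x * (/ 36 * N ^ 2 * ln N) by apply: Rmult_le_compat_l; Lra.lra.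
  have : x * N ^ 2 <= 9.
    have : x * N ^ 2 <= x * (3 * M) ^ 2.
      by apply: Rmult_le_compat_l; [Lra.lra | apply: pow_incr; Lra.lra].
    have -> : x * (3 * M) ^ 2 = 9 * (x * M ^ 2) by ring.
    by rewrite xM => ?; Lra.lra.
  move=> /(Rmult_le_compat_r _ _ _ lnN).
  have -> : x * (/ 36 * N ^ 2 * ln N) = / 36 * (x * N ^ 2 * ln N) by ring.
  move=> *; Lra.lra.
(* The coupon-collector bound [(1 - y)^m] is at most [exp (- y M)]. *)
have Pe : P <= / (1 + y * M).
  apply: Rle_trans Py _; apply: Rle_trans (pow_le_exp _ y1) _.
  by rewrite -/M -Ropp_mult_distr_l; apply: exp_neg_le_inv; apply: Rmult_le_pos; Lra.lra.
have yM : 0 < y * M by apply: Rmult_lt_0_compat; Lra.lra.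
have {Pe} Pe : P * (y * M) <= 1.
  have yM1 : 0 <= 1 + y * M by Lra.lra.
  have := Rmult_le_compat_r _ _ _ yM1 Pe.
  by rewrite Rinv_l ?Rmult_plus_distr_l; Lra.lra.
have sq : (P * P) * (y * y) * M ^ 2 <= 1.
  have -> : (P * P) * (y * y) * M ^ 2 = (P * (y * M)) * (P * (y * M)) by ring.
  have h0 : 0 <= P * (y * M) by apply: Rmult_le_pos; Lra.lra.
  Lra.nra.
have yyM : / (3 * M) <= y * y.
  by apply: (Rle_trans _ _ _ _ yN); apply: Rinv_le_contravar; Lra.lra.
have : (P * P) * / (3 * M) * M ^ 2 <= 1.
  apply: (Rle_trans _ _ _ _ sq); apply: Rmult_le_compat_r; first by apply: pow_le; Lra.lra.
  by apply: Rmult_le_compat_l => //; apply: Rmult_le_pos.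
have -> : (P * P) * / (3 * M) * M ^ 2 = P * P * (M / 3) by field; Lra.lra.
move=> h; apply: (Rmult_le_reg_r (M / 3)); first Lra.lra.
have -> : 3 / M * (M / 3) = 1; last by [].
by field; Lra.lra.
Qed.

End Asymptotics.

(** * Constants and witnesses for both bounds *)

Theorem theorem14 :
  (exists C C' : R, (0 < C)%R /\ (0 < C')%R /\
     forall (n : nat) (G0 : graph n), (2 <= n)%nat -> loopless G0 ->
       (rat_to_R (term_prob G0 (Z.to_nat (Rceil (C * INR n ^ 2 * ln (INR n)))))
         >= 1 - C' / INR n)%R)
  /\
  (exists c : R, (0 < c)%R /\
     exists (S : nat -> nat) (G : forall k : nat, graph (S k)),
       (forall k, (S k < S (k.+1))%nat) /\
       (forall k, loopless (G k) /\ weakly_connected (G k)) /\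
       Un_cv (fun k => rat_to_R (term_prob (G k)
                 (Z.to_nat (Rfloor (c * INR (S k) ^ 2 * ln (INR (S k)))))))%R 0%R).
Proof.
split.
  exists 8%R, 1%R; split; first Lra.lra; split; first Lra.lra.
  by move=> n G0 n2 _; apply: two_hop_upper.
exists (/ 36)%R; split; first Lra.lra.
(* The shift by 2 provides the condition [2 <= m] of [broom_slow]. *)
exists (fun k => k.+2.*2.+2), (fun k => broom k.+2).
split; first by move=> k /=; lia.
split; first by move=> k; split; [apply: broom_loopless | apply: broom_weakly_connected].
(* Beyond this threshold [3 / m < eps^2], which bounds the square of the probability. *)
move=> eps eps0; exists (Z.to_nat (up (3 / eps ^ 2))) => k kK.
have := @broom_slow k.+2 isT; cbv zeta.
set P := rat_to_R _ => PP.
have P0 : (0 <= P)%R by apply: rat_to_R_ge0; apply: term_prob_ge0.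
rewrite /Rdist Rminus_0_r Rabs_pos_eq //.
have kM : (3 / eps ^ 2 < INR k.+2)%R.
  have [up1 _] := archimed (3 / eps ^ 2).
  have pos : (0 < 3 / eps ^ 2)%R.
    by apply: Rdiv_lt_0_compat; [Lra.lra | apply: pow_lt].
  have : (IZR (up (3 / eps ^ 2)) <= INR k)%R.
    rewrite -(Z2Nat.id (up _)); last by apply: le_IZR; Lra.lra.
    by rewrite -INR_IZR_INZ; apply: le_INR.
  by rewrite 2!S_INR; Lra.lra.
have M0 : (0 < INR k.+2)%R by apply: lt_0_INR; apply/ltP.
have e2 : (0 < eps ^ 2)%R by apply: pow_lt.
have small : (3 / INR k.+2 < eps ^ 2)%R.
  apply: (Rmult_lt_reg_r (INR k.+2)) => //.
  have -> : (3 / INR k.+2 * INR k.+2 = 3 / eps ^ 2 * eps ^ 2)%R by field; split; Lra.lra.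
  by rewrite [(eps ^ 2 * _)%R]Rmult_comm; apply: Rmult_lt_compat_r.
by Lra.nra.
Qed.
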